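(* Let $R$ be a ring with at least two non-trivial annihilating ideals. Then the following statements are equivalent: (1) $\omega(\mathcal{EG}(R))=2$. (2) $\chi(\mathcal{EG}(R))=2$. (3) $\mathcal{EG}(R)$ is bipartite. (4) $\mathcal{EG}(R)$ is complete bipartite. (5) $\mathcal{EG}(R)\in\{K_{1,1},K_{1,\infty},K_{\infty,\infty}\}$. (6) $R$ is one of the following rings: (i) $R=\mathbb{F}_1\times\mathbb{F}_2$, where $\mathbb{F}_1,\mathbb{F}_2$ are two fields. (ii) $R=\mathbb{F}\times D$, where $\mathbb{F}$ is a field and $D$ is an integral domain. (iii) $R$ is reduced, $|\mathrm{Min}(R)|=2$ and $\mathrm{Soc}(R)=0$. (iv) $R$ is a ring with exactly two non-trivial ideals $\mathrm{Nil}(R)$, $\mathrm{Nil}(R)^2$. (v) $R$ has a minimal ideal $I_1$ such that $I_1$ is not an essential ideal of $R$, $I_1^2=(0)$, and for any non-zero annihilating ideal $I_2$ of $R$, $\mathrm{Ann}(I_2)=I_1$.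
   Context: All rings are commutative with identity. $\mathrm{Ann}(I)$ denotes the annihilator of an ideal $I$ of $R$. $A(R)$ is the set of ideals of $R$ with non-zero annihilator (annihilating ideals), and $A(R)^*=A(R)\setminus\{(0)\}$; an ideal is non-trivial if it is non-zero and proper. A ring is reduced if $0$ is its only nilpotent element. $\mathrm{Min}(R)$ is the set of minimal prime ideals, $\mathrm{Nil}(R)$ the nilradical, and $\mathrm{Soc}(R)$ the sum of all minimal (simple) ideals of $R$ (zero if there are none). A non-zero ideal $I$ of $R$ is essential, written $I\leq_e R$, if it has non-zero intersection with every non-zero ideal of $R$. The essential annihilating-ideal graph $\mathcal{EG}(R)$ is the simple graph with vertex set $A(R)^*$ in which two distinct vertices $I,J$ are adjacent if and only if $\mathrm{Ann}(IJ)\leq_e R$. $\omega(G)$ and $\chi(G)$ denote the clique number and vertex chromatic number of a graph $G$. $K_{m,n}$ is the complete bipartite graph with parts of sizes $m$ and $n$, where the symbol $\infty$ means that the corresponding part is infinite.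
   Formalization: In (6)(v), Ann(I_2)=I_1 is required only for non-zero annihilating ideals I_2 different from I_1; with I_2=I_1 allowed, (v) is impossible and the equivalence fails, e.g. for the idealization of Z by Z/p, whose graph is K_{1,∞}. *)

(* Defs.v *)
(* MathComp, with the classical sets of MathComp-Analysis. *)
From HB Require Import structures.
From mathcomp Require Import all_boot all_algebra.
From mathcomp Require Import boolp classical_sets functions cardinality.

Set Implicit Arguments.
Unset Strict Implicit.
Unset Printing Implicit Defensive.

Import GRing.Theory.
Local Open Scope classical_set_scope.
Local Open Scope ring_scope.

(* The ideals of ring_quotient.v are proper and decidable; those below are
   arbitrary subsets of a possibly zero ring. *)
Section Ideals.
Variable R : comPzRingType.
Implicit Types (I J P : set R).

Definition is_ideal I : Prop :=
  [/\ I 0, forall x y, I x -> I y -> I (x + y) & forall a x, I x -> I (a * x)].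

Definition nontrivial_ideal I : Prop :=
  [/\ is_ideal I, I <> [set 0] & I <> setT].

Definition idealM I J : set R :=
  [set x | exists n (a b : 'I_n -> R),
     [/\ forall i, I (a i), forall i, J (b i) & x = \sum_(i < n) a i * b i]].

Definition Ann I : set R := [set x | forall y, I y -> x * y = 0].

Definition annihilating_ideal I : Prop := is_ideal I /\ Ann I <> [set 0].

Definition essential_ideal I : Prop :=
  [/\ is_ideal I, I <> [set 0] &
      forall J, is_ideal J -> J <> [set 0] -> I `&` J <> [set 0]].

Definition minimal_ideal I : Prop :=
  [/\ is_ideal I, I <> [set 0] &
      forall J, is_ideal J -> J <> [set 0] -> J `<=` I -> J = I].

Definition prime_ideal P : Prop :=
  [/\ is_ideal P, P <> setT & forall x y, P (x * y) -> P x \/ P y].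

End Ideals.

Definition Min (R : comPzRingType) : set (set R) :=
  [set P | prime_ideal P /\
           forall Q : set R, prime_ideal Q -> Q `<=` P -> Q = P].
Arguments Min : clear implicits.

Definition nilradical (R : comPzRingType) : set R := [set x | exists n, x ^+ n = 0].
Arguments nilradical : clear implicits.

Definition reduced (R : comPzRingType) : Prop := forall x : R, nilradical R x -> x = 0.

(* The empty sum (n = 0) makes this the zero ideal when R has no minimal
   ideal. *)
Definition Soc (R : comPzRingType) : set R :=
  [set x | exists n (a : 'I_n -> R),
     (forall i, exists2 I : set R, minimal_ideal I & I (a i)) /\
     x = \sum_(i < n) a i].
Arguments Soc : clear implicits.

Definition ring_isomorphic (R S : pzRingType) : Prop :=
  exists f : {rmorphism R -> S}, bijective f.

(* The elements of T outside vset are not part of the graph. *)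
Record sgraph (T : Type) := SGraph {
  vset : set T;
  adj : T -> T -> Prop;
  adj_vset : forall x y, adj x y -> vset x;
  adj_sym : forall x y, adj x y -> adj y x;
  adj_irrefl : forall x, ~ adj x x
}.

Section Graphs.
Variables (T : Type) (G : sgraph T).

Definition is_clique (C : set T) : Prop :=
  C `<=` vset G /\ forall x y, C x -> C y -> x <> y -> adj G x y.

(* omega(G) = n *)
Definition clique_number_is (n : nat) : Prop :=
  (exists C, is_clique C /\ (C #= `I_n)%card) /\
  (forall m C, is_clique C -> (C #= `I_m)%card -> (m <= n)%N).

Definition colorable (k : nat) : Prop :=
  exists c : T -> nat,
    (forall x, vset G x -> (c x < k)%N) /\ (forall x y, adj G x y -> c x <> c y).

(* chi(G) = n *)
Definition chromatic_number_is (n : nat) : Prop :=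
  colorable n /\ forall m, colorable m -> (n <= m)%N.

Definition bipartition (V1 V2 : set T) : Prop :=
  [/\ V1 `|` V2 = vset G, V1 `&` V2 = set0,
      forall x y, V1 x -> V1 y -> ~ adj G x y &
      forall x y, V2 x -> V2 y -> ~ adj G x y].

Definition bipartite : Prop := exists V1 V2, bipartition V1 V2.

Definition complete_bipartition (V1 V2 : set T) : Prop :=
  bipartition V1 V2 /\ forall x y, V1 x -> V2 y -> adj G x y.

Definition complete_bipartite : Prop :=
  exists V1 V2, [/\ complete_bipartition V1 V2, V1 !=set0 & V2 !=set0].

(* None stands for the symbol oo: an infinite set of any cardinality. *)
Definition has_size (A : set T) (k : option nat) : Prop :=
  if k is Some n then (A #= `I_n)%card else infinite_set A.

(* G is K_{m,n} *)
Definition is_K (m n : option nat) : Prop :=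
  exists V1 V2, [/\ complete_bipartition V1 V2, has_size V1 m & has_size V2 n].

End Graphs.

Section EssentialAnnihilatingIdealGraph.
Variable R : comPzRingType.
Implicit Types I J : set R.

Definition EG_vertex : set (set R) :=
  [set I | annihilating_ideal I /\ I <> [set 0]].

Definition EG_adj I J : Prop :=
  [/\ EG_vertex I, EG_vertex J, I <> J & essential_ideal (Ann (idealM I J))].

Lemma idealMC I J : idealM I J = idealM J I.
Proof.
suff sub (A B : set R) : idealM A B `<=` idealM B A.
  by apply/seteqP; split; apply: sub.
move=> x [n [a [b [Aa Bb ->]]]]; exists n, b, a; split => //.
by apply: eq_bigr => i _; rewrite mulrC.
Qed.

Lemma EG_adj_vertex I J : EG_adj I J -> EG_vertex I.
Proof. by move=> []. Qed.

Lemma EG_adj_sym I J : EG_adj I J -> EG_adj J I.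
Proof.
by move=> [vI vJ neqIJ]; rewrite idealMC => eIJ; split=> //; apply/nesym.
Qed.

Lemma EG_adj_irrefl I : ~ EG_adj I I.
Proof. by move=> [_ _ neqII _]; apply: neqII. Qed.

Definition EG : sgraph (set R) :=
  SGraph EG_adj_vertex EG_adj_sym EG_adj_irrefl.

(* I2 <> I1 cannot be dropped from the last clause: a minimal ideal I1 with
   I1^2 = 0 is itself annihilating, and Ann I1 = I1 would make I1 the only
   non-trivial ideal of R, hence essential.  For R = Z (+) Z/p (idealization)
   and I1 = 0 (+) Z/p, all four clauses hold and EG is K_{1,oo}. *)
Definition has_nonessential_common_annihilator : Prop :=
  exists I1 : set R,
    [/\ minimal_ideal I1, ~ essential_ideal I1, idealM I1 I1 = [set 0] &
        forall I2, annihilating_ideal I2 -> I2 <> [set 0] -> I2 <> I1 ->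
                   Ann I2 = I1].

End EssentialAnnihilatingIdealGraph.

(* Main.v *)
(* A nilpotent generates an ideal adjacent to every other vertex, since its
   annihilator is essential.  So for a non-reduced ring a triangle-free graph
   is a star: with two vertices they form the chain Nil(R)^2 < Nil(R), and with
   more the centre is the only non-zero nilpotent principal ideal and the
   annihilator of every other vertex.  In a reduced ring adjacency means
   IJ = 0; if ab = 0 with a, b <> 0, triangle-freeness makes Ann(a) and Ann(b)
   prime with zero intersection, the parts are the non-zero ideals inside
   each of these primes, and a minimal ideal splits off a field.  A part is
   infinite as soon as the ideals (x^n) are pairwise distinct for some x in it;
   otherwise idempotents show that it is a single ideal. *)
Require Import Defs.
From HB Require Import structures.
From mathcomp Require Import all_boot all_algebra.
From mathcomp Require Import boolp classical_sets functions cardinality.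
From mathcomp Require Import ring.

Set Implicit Arguments.
Unset Strict Implicit.
Unset Printing Implicit Defensive.

Import GRing.Theory.

Local Open Scope classical_set_scope.
Local Open Scope ring_scope.

(** * Graphs *)

Section GraphFacts.
Variables (T : Type) (G : sgraph T).

Definition triangle_free := forall x y z, adj G x y -> adj G x z -> ~ adj G y z.

(** Edges for [i < j] suffice: symmetry of [adj] gives the others, and irreflexivity makes [f]
    injective on [I_n]. *)
Lemma clique_of_enum n (f : nat -> T) :
    (forall i, (i < n)%N -> vset G (f i)) ->
    (forall i j, (i < j < n)%N -> adj G (f i) (f j)) ->
  exists C, is_clique G C /\ (C #= `I_n)%card.
Proof.
move=> fV fA.
have fA' i j : (i < n)%N -> (j < n)%N -> i <> j -> adj G (f i) (f j).
  move=> ltin ltjn /eqP; rewrite neq_ltn => /orP[ltij|ltji].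
    by apply: fA; rewrite ltij.
  by apply/adj_sym/fA; rewrite ltji.
exists (f @` `I_n); split; [split|].
- by move=> _ [i /= lti <-]; exact: fV.
- move=> _ _ [i /= lti <-] [j /= ltj <-] neq; apply: fA' => // eqij.
  by case: neq; rewrite eqij.
- apply: inj_card_eq => i j /set_mem /= lti /set_mem /= ltj eqf.
  apply: contrapT => neq; have := fA' i j lti ltj neq.
  by rewrite eqf; exact: adj_irrefl.
Qed.

Lemma edge_clique x y : adj G x y -> exists C, is_clique G C /\ (C #= `I_2)%card.
Proof.
move=> xy; apply: (@clique_of_enum 2 (nth x [:: x; y])).
  by move=> [|[]//] _; [exact: (adj_vset xy)|exact: (adj_vset (adj_sym xy))].
by move=> [|[|i]] [|[|j]] //= /andP[].
Qed.

Lemma triangle_clique x y z : adj G x y -> adj G x z -> adj G y z ->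
  exists C, is_clique G C /\ (C #= `I_3)%card.
Proof.
move=> xy xz yz; apply: (@clique_of_enum 3 (nth x [:: x; y; z])).
  move=> [|[|[]//]] _; [exact: (adj_vset xy)|exact: (adj_vset yz)|].
  exact: (adj_vset (adj_sym xz)).
by move=> [|[|[|i]]] [|[|[|j]]] //= /andP[].
Qed.

(** A proper colouring is injective on a clique, so [C] is equipotent to its image, a subset of
    [I_k]. *)
Lemma colorable_clique_le k m C :
  colorable G k -> is_clique G C -> (C #= `I_m)%card -> (m <= k)%N.
Proof.
move=> [c [ck cA]] [CV CA] Cm; rewrite -card_le_II.
have /card_esym cC : (c @` C #= C)%card.
  apply: inj_card_eq => x y /set_mem Cx /set_mem Cy cxy; apply: contrapT => neq.
  exact: cA (CA _ _ Cx Cy neq) cxy.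
rewrite -(card_le_eql Cm) (card_le_eql cC).
by apply: subset_card_le => _ [x Cx <-]; apply/ck/CV.
Qed.

Lemma colorable2_triangle_free : colorable G 2 -> triangle_free.
Proof.
move=> col x y z xy xz yz; have [C [CC C3]] := triangle_clique xy xz yz.
by have := colorable_clique_le col CC C3.
Qed.

Lemma clique_number2_triangle_free : clique_number_is G 2 -> triangle_free.
Proof.
move=> [_ w2] x y z xy xz yz; have [C [CC C3]] := triangle_clique xy xz yz.
by have := w2 _ _ CC C3.
Qed.

Lemma bipartite_colorable2 : bipartite G -> colorable G 2.
Proof.
move=> [V1 [V2 [V12 _ A1 A2]]]; exists (fun x => `[< V2 x >] : nat).
split=> [x _|x y xy]; first by case: asboolP.
case: asboolP => Vx; case: asboolP => Vy // _; first exact: (A2 x y).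
have V1P z : vset G z -> ~ V2 z -> V1 z by rewrite -V12 => -[].
apply: (A1 x y) (xy); apply: V1P => //; first exact: (adj_vset xy).
exact: (adj_vset (adj_sym xy)).
Qed.

Lemma complete_bipartite_bipartite : complete_bipartite G -> bipartite G.
Proof. by move=> [V1 [V2 [[]]]]; exists V1, V2. Qed.

Lemma complete_bipartite_edge : complete_bipartite G -> exists x y, adj G x y.
Proof.
by move=> [V1 [V2 [[_ A] [x V1x] [y V2y]]]]; exists x, y; exact: A.
Qed.

Lemma complete_bipartite_clique_number2 :
  complete_bipartite G -> clique_number_is G 2.
Proof.
move=> cG; have [x [y xy]] := complete_bipartite_edge cG.
split; first exact: edge_clique xy.
move=> m C; apply: colorable_clique_le.
exact/bipartite_colorable2/complete_bipartite_bipartite.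
Qed.

Lemma complete_bipartite_chromatic_number2 :
  complete_bipartite G -> chromatic_number_is G 2.
Proof.
move=> cG; split.
  exact/bipartite_colorable2/complete_bipartite_bipartite.
have [x [y xy]] := complete_bipartite_edge cG.
have [C [CC C2]] := edge_clique xy.
by move=> m /colorable_clique_le/(_ CC C2).
Qed.

Lemma has_size_nonempty (A : set T) k :
  has_size A k -> k <> Some 0%N -> A !=set0.
Proof.
case: k => [n|] /=; last by move=> /infinite_setN0.
move=> An n0; apply/set0P/eqP => A0; move: An; rewrite A0 card_eq_sym.
by rewrite card_eq0; move=> /eqP/(congr1 (fun X => X 0%N)) /=; case: n n0 => // n _ <-.
Qed.

Lemma is_K_complete_bipartite m n :
  m <> Some 0%N -> n <> Some 0%N -> is_K G m n -> complete_bipartite G.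
Proof.
move=> m0 n0 [V1 [V2 [cV V1m V2n]]]; exists V1, V2; split=> //.
  exact: has_size_nonempty m0.
exact: has_size_nonempty n0.
Qed.

Lemma is_K_sym m n : is_K G m n -> is_K G n m.
Proof.
move=> [V1 [V2 [[[VU VI A1 A2] A] V1m V2n]]]; exists V2, V1; split=> //.
split; first by split; rewrite 1?setUC 1?setIC.
by move=> x y V2x V1y; apply/adj_sym/A.
Qed.

End GraphFacts.

(** * Ideals and adjacency *)

Section IdealFacts.
Variable R : comPzRingType.
Implicit Types (I J K P Q : set R) (x y z e r : R).

Definition princ x : set R := [set y | exists r, y = r * x].

Lemma princ_ideal x : is_ideal (princ x).
Proof.
split=> [|_ _ [r ->] [s ->]|a _ [r ->]]; first by exists 0; rewrite mul0r.
  by exists (r + s); rewrite mulrDl.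
by exists (a * r); rewrite mulrA.
Qed.

Lemma princ_id x : princ x x.
Proof. by exists 1; rewrite mul1r. Qed.

Lemma princ_sub I x : is_ideal I -> I x -> princ x `<=` I.
Proof. by move=> [_ _ IM] Ix _ [r ->]; exact: IM. Qed.

Lemma ideal_neq0P I : is_ideal I -> I <> [set 0] <-> exists2 x, I x & x != 0.
Proof.
move=> [I0 _ _]; split=> [In0|[x Ix x0] I_0]; last first.
  by move: Ix; rewrite I_0 => /= x0'; rewrite x0' eqxx in x0.
apply: contrapT => all0; apply: In0; apply/seteqP; split=> [x Ix|_ -> //].
by apply: contrapT => /eqP x0; apply: all0; exists x.
Qed.

Lemma ideal_neqTP I : is_ideal I -> I <> setT <-> ~ I 1.
Proof.
move=> [_ _ IM]; split=> [IT I1|I1 IT]; last by apply: I1; rewrite IT.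
by apply: IT; apply/seteqP; split=> // x _; rewrite -[x]mulr1; exact: IM.
Qed.

Lemma Ann_ideal K : is_ideal (Ann K).
Proof.
split=> [y _|x y Ax Ay z Kz|a x Ax z Kz]; first by rewrite mul0r.
  by rewrite mulrDl Ax // Ay // addr0.
by rewrite -mulrA Ax // mulr0.
Qed.

Lemma Ann_princP x z : Ann (princ x) z <-> z * x = 0.
Proof.
split=> [|zx _ [r ->]]; first by apply; exact: princ_id.
by rewrite mulrCA zx mulr0.
Qed.

Lemma Ann_idealMP I J z :
  Ann (idealM I J) z <-> forall x y, I x -> J y -> z * (x * y) = 0.
Proof.
split=> [Az x y Ix Jy|Az _ [n [a [b [Ia Jb ->]]]]].
  apply: Az; exists 1%N, (fun=> x), (fun=> y); split=> //.
  by rewrite big_ord_recl big_ord0 addr0.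
by rewrite mulr_sumr big1 // => i _; exact: Az.
Qed.

Lemma idealM_mul I J x y : I x -> J y -> idealM I J (x * y).
Proof.
move=> Ix Jy; exists 1%N, (fun=> x), (fun=> y); split=> //.
by rewrite big_ord_recl big_ord0 addr0.
Qed.

Lemma idealM_ideal I J : is_ideal I -> is_ideal (idealM I J).
Proof.
move=> [I0 ID IM]; split.
- by exists 0%N, (fun=> 0), (fun=> 0); split; rewrite ?big_ord0 // => -[].
- move=> _ _ [m [a [b [Ia Jb ->]]]] [n [c [d [Ic Jd ->]]]].
  exists (m + n)%N, (fun i => match fintype.split i with inl j => a j | inr k => c k end).
  exists (fun i => match fintype.split i with inl j => b j | inr k => d k end).
  split=> [i|i|]; try by case: (fintype.split i).
  rewrite big_split_ord; congr (_ + _); apply: eq_bigr => i _.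
    by rewrite (unsplitK (inl i)).
  by rewrite (unsplitK (inr i)).
- move=> r _ [n [a [b [Ia Jb ->]]]]; exists n, (fun i => r * a i), b.
  split=> // [i|]; first exact: IM.
  by rewrite mulr_sumr; apply: eq_bigr => i _; rewrite mulrA.
Qed.

Lemma idealM_sub I J K : is_ideal K ->
  (forall x y, I x -> J y -> K (x * y)) -> idealM I J `<=` K.
Proof.
move=> [K0 KD _] IJK _ [n [a [b [Ia Jb ->]]]].
by elim/big_ind: _ => // i _; exact: IJK.
Qed.

(** Essentiality can be tested on principal ideals, since a non-zero ideal contains a non-zero one
    of these. The non-zero element of [R] yields [I <> 0] in the backward direction. *)
Lemma essential_idealP I : is_ideal I -> (exists x, x != 0 :> R) ->
  essential_ideal I <-> forall y, y != 0 -> exists r, r * y != 0 /\ I (r * y).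
Proof.
move=> iI [w w0]; split=> [[_ In0 Iess] y y0|Iess].
  have yn0 : princ y <> [set 0].
    by apply/(ideal_neq0P (princ_ideal y)); exists y => //; exact: princ_id.
  apply: contrapT => noy; apply: (Iess _ (princ_ideal y) yn0).
  apply/seteqP; split=> [z [Iz [r zE]]|_ ->] /=.
    rewrite zE in Iz *; by apply: contrapT => /eqP ry0; apply: noy; exists r.
  by split; [case: iI|case: (princ_ideal y)].
split=> // [|J iJ /(ideal_neq0P iJ)[y Jy y0] IJ0].
  apply/(ideal_neq0P iI); have [r [rw Irw]] := Iess w w0.
  by exists (r * w).
have [r [ry0 Iry]] := Iess y y0; move/eqP: ry0; apply.
suff : (I `&` J) (r * y) by rewrite IJ0.
by split=> //; case: iJ => _ _; apply.
Qed.

Lemma EG_vertexP I : EG_vertex I <->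
  [/\ is_ideal I, exists2 x, I x & x != 0 &
      exists2 y, y != 0 & forall x, I x -> y * x = 0].
Proof.
split=> [[[iI An0] In0]|[iI In0 [y y0 yI]]].
  split=> //; first exact/(ideal_neq0P iI).
  by have /(ideal_neq0P (Ann_ideal I))[y Ay y0] := An0; exists y.
split; last exact/(ideal_neq0P iI).
by split=> //; apply/(ideal_neq0P (Ann_ideal I)); exists y.
Qed.

Lemma EG_adjP I J : EG_vertex I -> EG_vertex J -> I <> J ->
  EG_adj I J <-> forall y, y != 0 ->
    exists r, r * y != 0 /\ forall a b, I a -> J b -> r * y * (a * b) = 0.
Proof.
move=> vI vJ IJ; have /EG_vertexP[iI [w _ w0] _] := vI.
have nz : exists x, x != 0 :> R by exists w.
have essP := essential_idealP (Ann_ideal (idealM I J)) nz.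
split=> [[_ _ _ /essP ess] y y0|ess].
  by have [r [ry /Ann_idealMP Ary]] := ess y y0; exists r.
split=> //; apply/essP => y /ess[r [ry Ary]]; exists r; split=> //.
exact/Ann_idealMP.
Qed.

Lemma EG_adj_mul0 I J : EG_vertex I -> EG_vertex J -> I <> J ->
  (forall x y, I x -> J y -> x * y = 0) -> EG_adj I J.
Proof.
move=> vI vJ IJ IJ0; apply/EG_adjP => // y y0; exists 1; rewrite mul1r.
by split=> // a b Ia Jb; rewrite (IJ0 a b) // mulr0.
Qed.

Lemma princ_vertex x y : x != 0 -> y != 0 -> x * y = 0 -> EG_vertex (princ x).
Proof.
move=> x0 y0 xy; apply/EG_vertexP; split; first exact: princ_ideal.
  by exists x => //; exact: princ_id.
by exists y => // _ [r ->]; rewrite mulrCA [y * x]mulrC xy mulr0.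
Qed.

(** The factor [r] is the last power of [x] that does not kill [y]. In other words, the annihilator
    of a nilpotent is essential. *)
Lemma nilpotent_kills x y : nilradical R x -> y != 0 ->
  exists r, r * y != 0 /\ x * (r * y) = 0.
Proof.
move=> [n xn] y0; have ex : exists n, x ^+ n * y == 0.
  by exists n; rewrite xn mul0r.
case: (ex_minnP ex) => -[|m] /eqP xm mmin.
  by move: xm y0; rewrite expr0 mul1r => ->; rewrite eqxx.
exists (x ^+ m); split; last by rewrite mulrA -exprS.
by apply/negP => /mmin; rewrite ltnn.
Qed.

Lemma nilpotent_vertex x : nilradical R x -> x != 0 -> EG_vertex (princ x).
Proof.
move=> nx x0; have one0 : (1 : R) != 0.
  by apply: contra_neq x0 => one0; rewrite -[x]mulr1 one0 mulr0.
have [r [r0 xr]] := nilpotent_kills nx one0.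
by apply: princ_vertex x0 r0 xr.
Qed.

Lemma nilpotent_adj x J : nilradical R x -> x != 0 -> EG_vertex J ->
  princ x <> J -> EG_adj (princ x) J.
Proof.
move=> nx x0 vJ neq; apply/EG_adjP => //; first exact: nilpotent_vertex.
move=> y /(nilpotent_kills nx)[r [ry xry]]; exists r; split=> // _ b [s ->] _.
have -> : r * y * (s * x * b) = x * (r * y) * (s * b) by ring.
by rewrite xry mul0r.
Qed.

(** The element [u = r * x ^+ (m - n)] fixes [x ^+ n.+1], and so do its powers. Moreover [u ^+ n.+1]
    is a multiple of [x ^+ n.+1], because [(m - n) * n.+1 >= n.+1]; it therefore fixes itself. *)
Lemma powers_idempotent x n m r : (n < m)%N -> x ^+ n.+1 = r * x ^+ m.+1 ->
  exists e, [/\ e * e = e, princ (x ^+ n.+1) e & e * x ^+ n.+1 = x ^+ n.+1].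
Proof.
move=> ltnm xnm; set u := r * x ^+ (m - n).
have ux : u * x ^+ n.+1 = x ^+ n.+1.
  by rewrite -mulrA -exprD addnS subnK ?(ltnW ltnm).
have uxk k : u ^+ k * x ^+ n.+1 = x ^+ n.+1.
  by elim: k => [|k IH]; rewrite ?mul1r // exprS -mulrA IH.
have [s us] : princ (x ^+ n.+1) (u ^+ n.+1).
  rewrite exprMn -exprM; exists (r ^+ n.+1 * x ^+ ((m - n) * n.+1 - n.+1)).
  by rewrite -mulrA -exprD subnK // leq_pmull ?subn_gt0.
exists (u ^+ n.+1); split=> //; last by exists s.
by rewrite {2 3}us mulrCA uxk.
Qed.

(** Either the ideals generated by the positive powers of [x] are pairwise distinct, or a
    coincidence between two of them provides an idempotent. *)
Lemma powers_infinite (A : set (set R)) x :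
    (forall n, A (princ (x ^+ n.+1))) ->
  infinite_set A \/ exists n e,
    [/\ e * e = e, princ (x ^+ n.+1) e & e * x ^+ n.+1 = x ^+ n.+1].
Proof.
move=> Ax; case: (pselect (exists n m, (n < m)%N /\
    princ (x ^+ n.+1) = princ (x ^+ m.+1))) => [[n [m [ltnm eqnm]]]|ninj].
  right; have : princ (x ^+ m.+1) (x ^+ n.+1) by rewrite -eqnm; exact: princ_id.
  by move=> [r xr]; exists n; exact: powers_idempotent ltnm xr.
left; pose f n := princ (x ^+ n.+1); have fI : injective f.
  move=> n m; wlog ltnm : n m / (n < m)%N => [hw|fnm].
    by case: (ltngtP n m) => // [|/hw h /esym/h //]; exact: hw.
  by case: ninj; exists n, m.
have fA : f @` setT `<=` A by move=> _ [n _ <-]; exact: Ax.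
apply: (sub_infinite_set fA) => fin; apply: infinite_nat.
by rewrite -(eq_finite_set (@inj_card_eq _ _ setT f _)) // => ? ? _ _; exact: fI.
Qed.

End IdealFacts.

(** * Corner rings of idempotents *)

Section CornerRing.
Variables (R : comPzRingType) (e : R).

(** For an idempotent [e] this is the ideal [eR], given by an equation so that membership is
    boolean. *)
Definition corner_pred : {pred R} := [pred x | x * e == x].

Lemma corner_pred_zmod_closed : zmod_closed corner_pred.
Proof.
split=> [|x y]; rewrite !inE ?mul0r // => /eqP xe /eqP ye.
by rewrite mulrBl xe ye.
Qed.

HB.instance Definition _ :=
  GRing.isZmodClosed.Build R corner_pred corner_pred_zmod_closed.

(** Both hypotheses are arguments of the type so that the ring instances, whose laws rest on them,
    can be inferred from it. The unit of this ring is [e]. *)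
Definition corner of e * e = e & e != 0 := {x : R | x \in corner_pred}.

Hypotheses (ee : e * e = e) (e0 : e != 0).
Local Notation C := (corner ee e0).

HB.instance Definition _ := SubType.on C.
HB.instance Definition _ := [Choice of C by <:].
HB.instance Definition _ := [SubChoice_isSubZmodule of C by <:].

Lemma cornerP (x : C) : \val x * e = \val x.
Proof. exact/eqP/(valP x). Qed.

Lemma corner_proj_subproof x : x * e \in corner_pred.
Proof. by rewrite inE -mulrA ee. Qed.

Definition to_corner x : C := Sub (x * e) (corner_proj_subproof x).

Lemma val_to_corner x : \val (to_corner x) = x * e.
Proof. exact: SubK. Qed.

Definition corner_mul (x y : C) : C := to_corner (\val x * \val y).

Lemma val_corner_mul x y : \val (corner_mul x y) = \val x * \val y.
Proof. by rewrite val_to_corner -mulrA cornerP. Qed.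

Lemma corner_mulA : associative corner_mul.
Proof. by move=> x y z; apply: val_inj; rewrite !val_corner_mul mulrA. Qed.

Lemma corner_mulC : commutative corner_mul.
Proof. by move=> x y; apply: val_inj; rewrite !val_corner_mul mulrC. Qed.

Lemma corner_mul1 : left_id (to_corner 1) corner_mul.
Proof.
by move=> x; apply: val_inj; rewrite val_corner_mul val_to_corner mul1r mulrC cornerP.
Qed.

Lemma corner_mulDl : left_distributive corner_mul +%R.
Proof.
move=> x y z; apply: val_inj.
by rewrite val_corner_mul !raddfD mulrDl -!val_corner_mul.
Qed.

Lemma corner_oner_neq0 : to_corner 1 != 0.
Proof. by apply/eqP => /(congr1 \val); rewrite val_to_corner mul1r raddf0; apply/eqP. Qed.

HB.instance Definition _ := GRing.Zmodule_isComNzRing.Build C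
  corner_mulA corner_mulC corner_mul1 corner_mulDl corner_oner_neq0.

(** Integral domains and fields are built on rings with a total inverse, so units are decided
    classically and inverses are chosen. Non-units are their own inverse, as the interface
    demands. *)
Definition corner_unit : {pred C} := [pred x | `[< exists y : C, y * x = 1 >]].

Definition corner_inv (x : C) : C :=
  if pselect (exists y : C, y * x = 1) is left xV then projT1 (cid xV) else x.

Lemma corner_mulVx : {in corner_unit, left_inverse 1 corner_inv *%R}.
Proof.
move=> x /asboolP xU; rewrite /corner_inv; case: pselect => // xV.
exact: (projT2 (cid xV)).
Qed.

Lemma corner_unitPl (x y : C) : y * x = 1 -> corner_unit x.
Proof. by move=> yx; apply/asboolP; exists y. Qed.

Lemma corner_invr_out : {in [predC corner_unit], corner_inv =1 id}.
Proof. by move=> x /asboolP xU; rewrite /corner_inv; case: pselect. Qed.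

HB.instance Definition _ := GRing.ComNzRing_hasMulInverse.Build C
  corner_mulVx corner_unitPl corner_invr_out.

Lemma to_corner_is_zmod_morphism : zmod_morphism to_corner.
Proof.
move=> x y; apply: val_inj; rewrite raddfB.
by rewrite -[LHS]/(\val (to_corner (x - y))) !val_to_corner mulrBl.
Qed.

Lemma to_corner_is_monoid_morphism : monoid_morphism to_corner.
Proof.
split=> // x y; apply: val_inj; rewrite val_corner_mul !val_to_corner.
by rewrite mulrACA ee.
Qed.

HB.instance Definition _ :=
  GRing.isZmodMorphism.Build R C to_corner to_corner_is_zmod_morphism.
HB.instance Definition _ :=
  GRing.isMonoidMorphism.Build R C to_corner to_corner_is_monoid_morphism.

(** The projection [p] and the inclusion [i] are returned with the domain, so that the splitting of
    [R] can be built without unfolding the corner ring. *)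
Lemma corner_idomain :
    (forall x y, x * e = x -> y * e = y -> x * y = 0 -> x = 0 \/ y = 0) ->
  exists (D : idomainType) (p : {rmorphism R -> D}) (i : D -> R),
    cancel i p /\ forall x, i (p x) = x * e.
Proof.
move=> dom.
have domC : GRing.integral_domain_axiom C.
  move=> x y /(congr1 \val); rewrite raddf0 val_corner_mul => xy0.
  case: (dom _ _ (cornerP x) (cornerP y) xy0) => z0; apply/orP; [left|right];
  by apply/eqP/val_inj; rewrite z0 raddf0.
pose D : idomainType := HB.pack C (GRing.ComUnitRing_isIntegral.Build C domC).
exists D, (to_corner : {rmorphism R -> C}), \val; split => [x|x].
  by apply: val_inj; rewrite val_to_corner cornerP.
by rewrite val_to_corner.
Qed.

Lemma corner_field :
    (forall x, x * e = x -> x != 0 -> exists y, y * x = e) ->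
  exists (D : fieldType) (p : {rmorphism R -> D}) (i : D -> R),
    cancel i p /\ forall x, i (p x) = x * e.
Proof.
move=> inv.
have fieldC : GRing.field_axiom C.
  move=> x x0; have [|y yx] := inv _ (cornerP x).
    by apply: contra_neq x0 => x0; apply: val_inj; rewrite x0 raddf0.
  apply/asboolP; exists (to_corner y); apply: val_inj.
  by rewrite val_corner_mul !val_to_corner mul1r mulrAC -mulrA cornerP yx.
pose D : fieldType := HB.pack C (GRing.ComUnitRing_isField.Build C fieldC).
exists D, (to_corner : {rmorphism R -> C}), \val; split => [x|x].
  by apply: val_inj; rewrite val_to_corner cornerP.
by rewrite val_to_corner.
Qed.

End CornerRing.

(** Peirce decomposition: [x] goes to the pair of its images in [eR] and [(1 - e)R], and the inverse
    adds the two components. The hypotheses make the first corner a field and the second a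
    domain. *)
Lemma idempotent_splits (R : comPzRingType) (e : R) :
    e * e = e -> e != 0 -> 1 - e != 0 ->
    (forall x, x * e = x -> x != 0 -> exists y, y * x = e) ->
    (forall x y, x * (1 - e) = x -> y * (1 - e) = y -> x * y = 0 ->
       x = 0 \/ y = 0) ->
  exists (F : fieldType) (D : idomainType), ring_isomorphic R (F * D)%type.
Proof.
move=> ee e0 e1 inv dom; have e'e' : (1 - e) * (1 - e) = 1 - e by ring: ee.
have [F [p [i [ip pi]]]] := corner_field ee e0 inv.
have [D [q [j [jq qj]]]] := corner_idomain e'e' e1 dom.
exists F, D.
pose f x : (F * D)%type := (p x, q x).
have fB : zmod_morphism f by move=> x y; rewrite /f !rmorphB.
have fM : monoid_morphism f.
  by split=> [|x y]; rewrite /f ?rmorph1 ?rmorphM.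
pose fR : {rmorphism R -> (F * D)%type} := HB.pack f
  (GRing.isZmodMorphism.Build _ _ f fB) (GRing.isMonoidMorphism.Build _ _ f fM).
exists fR; exists (fun z => i z.1 + j z.2) => [x|[u v]].
  by rewrite /= pi qj -mulrDr addrC subrK mulr1.
(* The cross terms vanish because [i u] lies in [eR] and [j v] in [(1 - e)R]. *)
have ie : i u * (1 - e) = 0.
  by rewrite -{1}(ip u) pi mulrBr mulr1 -mulrA ee subrr.
have je : j v * e = 0.
  by rewrite -{1}(jq v) qj -mulrA mulrBl mul1r ee subrr mulr0.
have ci : p (j v) = 0 by rewrite -(ip (p _)) pi je; exact: rmorph0.
have cj : q (i u) = 0 by rewrite -(jq (q _)) qj ie; exact: rmorph0.
by rewrite /= /f !rmorphD ci cj addr0 add0r ip jq.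
Qed.

(** * Two primes with zero intersection *)

Lemma prime_exp (R : comPzRingType) (P : set R) x n :
  prime_ideal P -> P (x ^+ n) -> P x.
Proof.
move=> [iP PT Pm]; elim: n => [|n IH]; last by rewrite exprS => /Pm[].
by rewrite expr0 => P1; case/(ideal_neqTP iP): PT.
Qed.

Section SplittingPrimes.
Variable R : comPzRingType.
Implicit Types (I J P Q : set R) (x y z e r : R).

(** Common form of the reduced cases: [R] embeds in [R/P x R/Q]. As both primes are non-zero with
    zero intersection, neither contains the other. *)
Definition splitting_primes P Q :=
  [/\ prime_ideal P, prime_ideal Q, forall x, P x -> Q x -> x = 0,
      exists2 x, P x & x != 0 & exists2 x, Q x & x != 0].

Definition ideals_within P : set (set R) :=
  [set I | [/\ is_ideal I, I <> [set 0] & I `<=` P]].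

Lemma splitting_primes_sym P Q : splitting_primes P Q -> splitting_primes Q P.
Proof. by move=> [pP pQ PQ0 Pn Qn]; split=> // x Qx Px; exact: PQ0. Qed.

Lemma splitting_primes_mul0 P Q x y :
  splitting_primes P Q -> P x -> Q y -> x * y = 0.
Proof.
move=> [[[_ _ PM] _ _] [[_ _ QM] _ _] PQ0 _ _] Px Qy; apply: PQ0.
  by rewrite mulrC; exact: PM.
exact: QM.
Qed.

(** One of the factors lies in the prime [Q], hence in the zero intersection. *)
Lemma splitting_primes_mul_neq0 P Q x y : splitting_primes P Q ->
  P x -> P y -> x * y = 0 -> x = 0 \/ y = 0.
Proof.
move=> [_ [[Q0 _ _] _ Qm] PQ0 _ _] Px Py xy0.
have Qxy : Q (x * y) by rewrite xy0.
by case: (Qm _ _ Qxy) => ?; [left|right]; exact: PQ0.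
Qed.

Lemma splitting_primes_reduced P Q : splitting_primes P Q -> reduced R.
Proof.
move=> [pP pQ PQ0 _ _] x [n xn]; case: (pP) (pQ) => [[P0 _ _] _ _] [[Q0 _ _] _ _].
by apply: PQ0; [apply: (prime_exp pP (n := n))|apply: (prime_exp pQ (n := n))];
   rewrite xn.
Qed.

(** Across the parts products vanish, since they lie in both primes. Inside a part there is no edge,
    since [P] has no zero divisors of its own, and neither has [Q]. *)
Lemma splitting_primes_bipartition P Q : splitting_primes P Q ->
  complete_bipartition (EG R) (ideals_within P) (ideals_within Q).
Proof.
move=> sPQ; have [[iP _ Pm] [iQ _ Qm] PQ0 [p Pp p0] [q Qq q0]] := sPQ.
have sQP := splitting_primes_sym sPQ.
have vtx A B a : splitting_primes A B -> B a -> a != 0 ->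
    ideals_within A `<=` EG_vertex (R := R).
  move=> sAB Ba a0 I [iI /(ideal_neq0P iI) In0 IA].
  apply/EG_vertexP; split=> //; exists a => // x /IA Ax.
  by rewrite mulrC; exact: splitting_primes_mul0 sAB Ax Ba.
have nadj A B I J : splitting_primes A B -> ideals_within A I ->
    ideals_within A J -> ~ EG_adj I J.
  move=> sAB [iI /(ideal_neq0P iI)[x Ix x0] IA] [iJ /(ideal_neq0P iJ)[y Jy y0] JA].
  move=> aIJ; case: (aIJ) => vI vJ IJ _.
  have Axy : A (x * y) by case: sAB => -[[_ _ AM] _ _] _ _ _ _; apply/AM/JA.
  have xy0 : x * y != 0.
    apply/eqP => /(splitting_primes_mul_neq0 sAB (IA _ Ix) (JA _ Jy)).
    by case=> z0; [move/eqP: x0 | move/eqP: y0].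
  (* Testing essentiality on [x * y] itself gives a non-zero multiple of [x * y] that kills [x * y],
     with both factors in [A]. *)
  have [r [rxy rxyxy]] := (EG_adjP vI vJ IJ).1 aIJ _ xy0.
  have Arxy : A (r * (x * y)) by case: sAB => -[[_ _ AM] _ _] _ _ _ _; apply/AM.
  have [/eqP|/eqP] := splitting_primes_mul_neq0 sAB Arxy Axy (rxyxy _ _ Ix Jy).
    by apply/negP.
  by apply/negP.
split; last first.
  move=> I J wI wJ; apply: EG_adj_mul0; [exact: (vtx P Q q) wI|exact: (vtx Q P p) wJ| |].
    move=> IJ; case: wI wJ => iI /(ideal_neq0P iI)[x Ix /eqP x0] IP [_ _ JQ].
    by apply/x0/PQ0; [exact: IP | apply: JQ; rewrite -IJ].
  case: wI wJ => _ _ IP [_ _ JQ] x y /IP Px /JQ Qy.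
  exact: splitting_primes_mul0 sPQ Px Qy.
split.
- apply/seteqP; split=> [I [wI|wI]|I /EG_vertexP[iI In0 [y y0 yI]]].
  + exact: (vtx P Q q) wI.
  + exact: (vtx Q P p) wI.
  + move/(ideal_neq0P iI) in In0.
    (* The non-zero annihilator [y] avoids one of the two primes, and that prime then contains
       [I]. *)
    case: (pselect (P y)) => Py; [right|left]; split=> // x Ix.
      have /Qm[Qy|//] : Q (y * x) by rewrite yI //; case: iQ.
      by move/eqP: y0; case; exact: PQ0.
    have Pyx : P (y * x) by rewrite yI //; case: iP.
    by case: (Pm _ _ Pyx).
- apply/seteqP; split=> // I [[iI /(ideal_neq0P iI)[x Ix /eqP x0] IP] [_ _ IQ]].
  by apply/x0/PQ0; [exact: IP | exact: IQ].
- by move=> I J; exact: nadj sPQ.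
- by move=> I J; exact: nadj sQP.
Qed.

(** If the part is finite, the powers of a non-zero [x] in any member [J] give a non-zero idempotent
    [e] in [J]. As [e] is not in [Q], [1 - e] is, so [P] is killed by [1 - e] and [w = w * e] lies
    in [J] for every [w] in [P]; thus [J = P]. *)
Lemma ideals_within_size P Q : splitting_primes P Q ->
  has_size (ideals_within P) (Some 1%N) \/ has_size (ideals_within P) None.
Proof.
move=> sPQ; have [[iP PT Pm] [iQ _ Qm] PQ0 [p Pp p0] _] := sPQ.
have red := splitting_primes_reduced sPQ.
case: (pselect (infinite_set (ideals_within P))) => [inf|fin]; [by right|left].
suff -> : ideals_within P = [set P] by exact: card_set1.
apply/seteqP; split=> [J [iJ /(ideal_neq0P iJ)[x Jx x0] JP]|_ ->]; last first.
  by split=> //; apply/(ideal_neq0P iP); exists p.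
apply/seteqP; split=> // w Pw.
have xn0 n : x ^+ n.+1 != 0.
  by apply: contra_neq x0 => xn; apply: red; exists n.+1.
have Jxn n : J (x ^+ n.+1) by rewrite exprSr; case: iJ => _ _; apply.
have [n|/fin //|[n [e [ee [s es] exn]]]] := @powers_infinite R (ideals_within P) x.
  split; first exact: princ_ideal.
    by apply/(ideal_neq0P (princ_ideal _)); exists (x ^+ n.+1) => //; exact: princ_id.
  by apply: princ_sub => //; exact: JP.
have Je : J e by rewrite es; case: iJ => _ _; apply.
have Qe' : Q (1 - e).
  have /Qm[Qe|//] : Q (e * (1 - e)).
    by rewrite mulrBr mulr1 ee subrr; case: iQ.
  have e0 : e = 0 by apply: PQ0 => //; exact: JP.
  by have := xn0 n; rewrite -exn e0 mul0r eqxx.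
have := splitting_primes_mul0 sPQ Pw Qe'; rewrite mulrBr mulr1 => /eqP.
by rewrite subr_eq0 => /eqP ->; case: iJ => _ _; apply.
Qed.

Lemma splitting_primes_is_K P Q : splitting_primes P Q ->
  is_K (EG R) (Some 1%N) (Some 1%N) \/
  is_K (EG R) (Some 1%N) None \/ is_K (EG R) None None.
Proof.
move=> sPQ; have sQP := splitting_primes_sym sPQ.
have bPQ := splitting_primes_bipartition sPQ.
have [Ps|Ps] := ideals_within_size sPQ; have [Qs|Qs] := ideals_within_size sQP.
- by left; exists (ideals_within P), (ideals_within Q).
- by right; left; exists (ideals_within P), (ideals_within Q).
- by right; left; apply: is_K_sym; exists (ideals_within P), (ideals_within Q).
- by right; right; exists (ideals_within P), (ideals_within Q).
Qed.

(** * Splitting primes obtained from the reduced ring classes *)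

(** The primes are the kernels of the two projections. A field being a domain, this serves both
    product classes. *)
Lemma domain_product_splitting_primes (F D : idomainType) :
  ring_isomorphic R (F * D)%type -> exists P Q, splitting_primes P Q.
Proof.
move=> [f [g fK gK]].
exists [set x | (f x).1 = 0], [set x | (f x).2 = 0]; split.
- split; first split=> [|x y|a x] /=; rewrite ?rmorph0 ?rmorphD ?rmorphM //=.
  + by move=> -> ->; rewrite addr0.
  + by move=> ->; rewrite mulr0.
  + move/(congr1 (fun X => X 1)) => /=; rewrite rmorph1 => F10.
    have : (1 : F) = 0 by rewrite F10.
    by move/eqP; rewrite oner_eq0.
  + move=> x y /=; rewrite rmorphM => /eqP; rewrite mulf_eq0.
    by case/orP => /eqP; [left|right].
- split; first split=> [|x y|a x] /=; rewrite ?rmorph0 ?rmorphD ?rmorphM //=.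
  + by move=> -> ->; rewrite addr0.
  + by move=> ->; rewrite mulr0.
  + move/(congr1 (fun X => X 1)) => /=; rewrite rmorph1 => F10.
    have : (1 : D) = 0 by rewrite F10.
    by move/eqP; rewrite oner_eq0.
  + move=> x y /=; rewrite rmorphM => /eqP; rewrite mulf_eq0.
    by case/orP => /eqP; [left|right].
- move=> x /= x1 x2; apply: (can_inj fK); rewrite rmorph0.
  by move: x1 x2; case: (f x) => a b /= -> ->.
- exists (g (0, 1)); first by rewrite /= gK.
  apply/eqP => /(congr1 f); rewrite gK rmorph0 => -[/eqP].
  by rewrite oner_eq0.
- exists (g (1, 0)); first by rewrite /= gK.
  apply/eqP => /(congr1 f); rewrite gK rmorph0 => -[/eqP].
  by rewrite oner_eq0.
Qed.

(* In a reduced ring the complement of a multiplicative set S maximal among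
   those containing the powers of x and avoiding 0 is a minimal prime: it is
   {y | s y = 0 for some s in S}. *)
Lemma reduced_minimal_prime_avoids x : reduced R -> x != 0 ->
  exists2 P, Min R P & ~ P x.
Proof.
move=> red x0.
pose mc (S : set R) :=
  [/\ forall n, S (x ^+ n), ~ S 0 & forall y z, S y -> S z -> S (y * z)].
have [S [[Sx S0 SM] Smax]] : exists S, mc S /\ forall B, S `<` B -> ~ mc B.
  (* [Zorn_bigcup] also treats the empty chain, whose union is empty; adjoining the powers of [x]
     makes that union admissible. *)
  pose U (A : set R) := [set x ^+ n | n in setT] `|` A.
  have [F FU totF|A [mcA Amax]] := @Zorn_bigcup R [set A | mc (U A)].
    split=> [n| |]; first by left; exists n.
    - case=> [[n _ xn]|[X /FU[_ U0 _] X0]]; last by apply: U0; right.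
      by move/eqP: x0; apply; apply: red; exists n.
    - have inU X y : F X -> U X y -> U (\bigcup_(X in F) X) y.
        by move=> FX [?|Xy]; [left|right; exists X].
      move=> y z [[m _ <-]|[X FX Xy]] [[n _ <-]|[Y FY Yz]].
      + by left; exists (m + n)%N => //; rewrite exprD.
      + have [Ux _ UM] := FU _ FY; apply: (inU Y) => //; apply: UM; last by right.
        by left; exists m.
      + have [Ux _ UM] := FU _ FX; apply: (inU X) => //; apply: UM; first by right.
        by left; exists n.
      + case: (totF _ _ FX FY) => sub.
          have [_ _ UM] := FU _ FY; apply: (inU Y) => //.
          by apply: UM; right => //; exact: sub.
        have [_ _ UM] := FU _ FX; apply: (inU X) => //.
        by apply: UM; right => //; exact: sub.
  exists (U A); split=> // B UAB mcB; apply: (Amax B).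
    split; first by move=> y Ay; apply: (properW UAB); right.
    by case: UAB => _ nBU BA; apply: nBU => y /BA; right.
  rewrite /mkset; suff -> : U B = B by [].
  apply/seteqP; split=> [y [[n _ <-]|//]|y By]; last by right.
  by case: mcB.
have S1 : S 1 by have := Sx 0%N; rewrite expr0.
have SV y : ~ S y -> exists2 s, S s & s * y = 0.
  move=> Sy; apply: contrapT => nos.
  (* This is the multiplicative set generated by [S] and [y]. If no [s] in [S] killed [y], it would
     avoid 0 and contradict maximality: [s * y ^+ n = 0] makes [s * y] nilpotent, hence zero. *)
  pose B : set R := [set z | exists s n, S s /\ z = s * y ^+ n].
  apply: (Smax B).
    split; first by move=> z Sz; exists z, 0%N; rewrite expr0 mulr1.
    by move=> BS; apply/Sy/BS; exists 1, 1%N; rewrite mul1r expr1.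
  split=> [n|[s [n [Ss s0]]]|_ _ [s [m [Ss ->]]] [t [n [St ->]]]].
  - by exists (x ^+ n), 0%N; rewrite expr0 mulr1.
  - apply: nos; exists s => //; apply: red; exists n.+1.
    by rewrite exprMn exprS exprSr mulrACA -s0 mul0r.
  - exists (s * t), (m + n)%N; split; first exact: SM.
    by rewrite exprD mulrACA.
have VS s y : S s -> s * y = 0 -> ~ S y.
  by move=> Ss sy Sy; apply: S0; rewrite -sy; exact: SM.
have iP : is_ideal (~` S).
  split=> // [y z /SV[s Ss sy] /SV[t St tz]|a y /SV[s Ss sy]].
    apply: (VS (s * t)); first exact: SM.
    have -> : s * t * (y + z) = t * (s * y) + s * (t * z) by ring.
    by rewrite sy tz !mulr0 addr0.
  by apply: (VS s) => //; rewrite mulrCA sy mulr0.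
have pP : prime_ideal (~` S).
  split=> //; first by apply/(ideal_neqTP iP) => /(_ S1).
  move=> y z Syz; case: (pselect (S y)) => Sy; [right|by left].
  by move=> Sz; apply/Syz/SM.
exists (~` S); last by move=> /(_ (Sx 1%N)).
(* Minimality: a prime [Q] inside the complement of [S] contains [s * y = 0] but not [s], hence
   contains [y]. *)
split=> // Q [[Q0 _ _] _ Qm] QS; apply/seteqP; split=> // y /SV[s Ss sy].
by have /Qm[/QS//|//] : Q (s * y) by rewrite sy.
Qed.

(** In a reduced ring the minimal primes meet in 0. Neither of the two is zero, since a zero one
    would lie inside the other and equal it by minimality. *)
Lemma Min2_splitting_primes : reduced R -> (Min R #= `I_2)%card ->
  exists P Q, splitting_primes P Q.
Proof.
move=> red /card_esym/card_set_bijP[f [fM finj fsurj]].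
have MP : Min R (f 0%N) by exact: fM.
have MQ : Min R (f 1%N) by exact: fM.
have PQ : f 0%N <> f 1%N.
  by move=> /finj; rewrite !inE => /(_ isT isT).
have neq0 A B : Min R A -> Min R B -> A <> B -> exists2 x, A x & x != 0.
  move=> [pA _] [[[B0 _ _] _ _] minB] AB; apply: contrapT => A0; apply: AB.
  apply: minB => // x Ax; suff -> : x = 0 by [].
  by apply: contrapT => /eqP x0; apply: A0; exists x.
exists (f 0%N), (f 1%N); split; [by case: MP|by case: MQ| | |].
- move=> x Px Qx; apply: contrapT => /eqP/(reduced_minimal_prime_avoids red)[M MM].
  by have [[|[|i]] // _ <-] := fsurj _ MM.
- exact: neq0 PQ.
- exact: neq0 (nesym PQ).
Qed.

End SplittingPrimes.

(** * Reduced rings *)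

Section Classification.
Variable R : comPzRingType.
Implicit Types (I J K P Q U V : set R) (a b x y z e r : R).

Lemma vertex_nontrivial I : EG_vertex I -> nontrivial_ideal I.
Proof.
move=> /EG_vertexP[iI In0 [y y0 yI]]; split=> //; first exact/(ideal_neq0P iI).
by apply/(ideal_neqTP iI) => /yI; rewrite mulr1; apply/eqP.
Qed.

Lemma annihilated_vertex I y : is_ideal I -> I <> [set 0] -> y != 0 ->
  (forall x, I x -> y * x = 0) -> EG_vertex I.
Proof.
by move=> iI /(ideal_neq0P iI) In0 y0 yI; apply/EG_vertexP; split=> //; exists y.
Qed.

Lemma square0_nilradical x : x * x = 0 -> nilradical R x.
Proof. by exists 2%N; rewrite expr2. Qed.

Lemma minimal_ideal_princ I x : minimal_ideal I -> I x -> x != 0 -> princ x = I.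
Proof.
move=> [iI _ minI] Ix x0; apply: minI; first exact: princ_ideal.
  by apply/(ideal_neq0P (princ_ideal _)); exists x => //; exact: princ_id.
exact: princ_sub.
Qed.

Lemma minimal_ideal_princP x : x != 0 ->
  (forall y, princ x y -> y != 0 -> princ y x) -> minimal_ideal (princ x).
Proof.
move=> x0 gen; split; first exact: princ_ideal.
  by apply/(ideal_neq0P (princ_ideal _)); exists x => //; exact: princ_id.
move=> J iJ /(ideal_neq0P iJ)[y Jy y0] Jx; apply/seteqP; split=> //.
apply: princ_sub => //; have [s ->] := gen y (Jx _ Jy) y0.
by case: iJ => _ _; apply.
Qed.

(** Apply [nilpotent_kills] with [y] equal to the nilpotent [x]: from [r * x <> 0] and
    [x * (r * x) = 0] follows that [r * x] squares to zero. *)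
Lemma not_reduced_square0 : ~ reduced R -> exists2 a : R, a != 0 & a * a = 0.
Proof.
move=> nred; have [x nx x0] : exists2 x : R, nilradical R x & x != 0.
  apply: contrapT => nx; apply: nred => x xn; apply: contrapT => /eqP x0.
  by apply: nx; exists x.
have [r [rx xrx]] := nilpotent_kills nx x0.
by exists (r * x) => //; rewrite -mulrA xrx mulr0.
Qed.

(** Three non-zero elements with pairwise zero products generate a triangle, their ideals being
    distinct by reducedness. Both the primality of the two annihilators and their zero intersection
    come from excluding such triples. *)
Lemma triangle_free_splitting_primes I :
    triangle_free (EG R) -> reduced R -> EG_vertex I ->
  exists P Q, splitting_primes P Q.
Proof.
move=> tf red /EG_vertexP[_ [a Ia a0] [b b0 bI]].
have ba : b * a = 0 by exact: bI.
have adj x y : x != 0 -> y != 0 -> x * y = 0 -> EG_adj (princ x) (princ y).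
  move=> x0 y0 xy; apply: EG_adj_mul0.
  - exact: princ_vertex x0 y0 xy.
  - by apply: princ_vertex y0 x0 _; rewrite mulrC.
  - move=> eqxy; have [r yE] : princ x y by rewrite eqxy; exact: princ_id.
    move/eqP: y0; apply; apply: red; apply: square0_nilradical.
    by rewrite {1}yE -mulrA xy mulr0.
  - by move=> _ _ [r ->] [s ->]; rewrite mulrACA xy mulr0.
have tri x y z : x != 0 -> y != 0 -> z != 0 ->
    x * y = 0 -> x * z = 0 -> y * z = 0 -> False.
  move=> x0 y0 z0 xy xz yz.
  exact: (tf (princ x) (princ y) (princ z)) (adj _ _ _ _ _) (adj _ _ _ _ _) (adj _ _ _ _ _).
have primeA (c d : R) : c != 0 -> d != 0 -> d * c = 0 -> prime_ideal [set z | z * c = 0].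
  move=> c0 d0 dc; have iA : is_ideal [set z | z * c = 0].
    split=> [|x y xc yc|x y yc] /=; first exact: mul0r.
      by rewrite mulrDl xc yc addr0.
    by rewrite -mulrA yc mulr0.
  split=> //; first by apply/(ideal_neqTP iA) => /=; rewrite mul1r; apply/eqP.
  move=> x y /= xyc; apply: contrapT => /not_orP[/eqP xc /eqP yc].
  (* If [x * y] kills [c] but neither factor does, then [x * c], [y * c] and [d] form a forbidden
     triple. *)
  apply: (tri (x * c) (y * c) d) => //.
  - by rewrite mulrACA mulrA xyc mul0r.
  - by rewrite -mulrA [c * d]mulrC dc mulr0.
  - by rewrite -mulrA [c * d]mulrC dc mulr0.
have ab : a * b = 0 by rewrite mulrC.
exists [set z | z * a = 0], [set z | z * b = 0]; split.
- exact: primeA ba.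
- exact: primeA ab.
- move=> z /= za zb; apply: contrapT => /eqP z0.
  exact: (tri z a b).
- by exists b.
- by exists a.
Qed.

(** Products of [P] with [Q] vanish, so every prime contains [P] or [Q]; as these are incomparable,
    they are exactly the minimal primes. *)
Lemma splitting_primes_Min P Q : splitting_primes P Q -> (Min R #= `I_2)%card.
Proof.
move=> sPQ; have sub (A B A' : set R) : splitting_primes A B -> prime_ideal A' ->
    ~ A `<=` A' -> B `<=` A'.
  move=> sAB [[A'0 _ _] _ A'm] nAA' x Bx; apply: contrapT => A'x; apply: nAA'.
  move=> y Ay; have : A' (y * x) by rewrite (splitting_primes_mul0 sAB Ay Bx).
  by case/A'm.
have sQP := splitting_primes_sym sPQ.
have nsubset (A B : set R) : splitting_primes A B -> ~ A `<=` B.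
  move=> [_ _ AB0 [x Ax x0] _] AB; move/eqP: x0; apply.
  by apply: AB0 => //; exact: AB.
have minA (A B : set R) : splitting_primes A B -> Min R A.
  move=> sAB; split; first by case: sAB.
  move=> A' pA' A'A; apply/seteqP; split=> //.
  apply: contrapT => /(sub _ _ _ sAB pA') BA'.
  by apply: (nsubset _ _ (splitting_primes_sym sAB)) => x /BA' /A'A.
have PQ : P <> Q by move=> PQ; apply: (nsubset _ _ sPQ); rewrite PQ.
have -> : Min R = nth P [:: P; Q] @` `I_2.
  apply/seteqP; split=> [A [pA minAA]|_ [[|[|i]] //= _ <-]].
  - case: (pselect (P `<=` A)) => PA.
      by exists 0%N => //=; apply: minAA => //; case: sPQ.
    have QA := sub _ _ _ sPQ pA PA.
    by exists 1%N => //=; apply: minAA => //; case: sPQ.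
  - exact: minA sPQ.
  - exact: minA sQP.
apply: inj_card_eq => -[|[|i]] [|[|j]] //=; rewrite ?inE //.
by move=> _ _ /esym.
Qed.

Lemma Soc_no_minimal : ~ (exists I : set R, minimal_ideal I) -> Soc R = [set 0].
Proof.
move=> nomin; apply/seteqP; split=> [_ [[|n] [a [aM ->]]]|_ ->].
- by rewrite big_ord0.
- by case: (aM ord0) => I mI; case: nomin; exists I.
- exists 0%N, (fun=> 0); split; last by rewrite big_ord0.
  by case.
Qed.

(** Reducedness gives [M = (x * x)], so [x = r * x * x] and [e = r * x] is an idempotent generating
    [M]. Minimality makes [eR] a field, and [(1 - e)R] is a domain because it lies inside one of the
    two primes. *)
Lemma splitting_primes_minimal_ideal P Q (M : set R) :
    splitting_primes P Q -> minimal_ideal M ->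
  exists (F : fieldType) (D : idomainType), ring_isomorphic R (F * D)%type.
Proof.
move=> sPQ mM; have red := splitting_primes_reduced sPQ.
have [[iP PT Pm] [[Q0 _ _] _ Qm] PQ0 Pn _] := sPQ.
have [iM /(ideal_neq0P iM)[x Mx x0] minM] := mM.
have xx0 : x * x != 0.
  by apply: contra_neq x0 => xx; apply/red/square0_nilradical.
have Mxx : M (x * x) by case: iM => _ _; apply.
have [r xE] : princ (x * x) x by rewrite (minimal_ideal_princ mM Mxx xx0).
pose e := r * x.
have ex : e * x = x by rewrite -mulrA -xE.
have ee : e * e = e by rewrite {2}/e mulrCA ex.
have Me : M e by case: iM => _ _; apply.
have e0 : e != 0 by apply: contra_neq x0 => e0; rewrite -ex e0 mul0r.
have e1 : 1 - e != 0.
  rewrite subr_eq0; apply/eqP => e1; apply: PT.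
  (* If [e = 1], then [M] is the whole ring and its minimality makes the non-zero ideal [P]
     improper. *)
  have PM : P = M.
    apply: minM => //; first exact/(ideal_neq0P iP).
    by move=> y _; rewrite -[y]mulr1 e1; case: iM => _ _; apply.
  by apply/seteqP; split=> // y _; rewrite PM -[y]mulr1 e1; case: iM => _ _; apply.
apply: (idempotent_splits ee e0 e1) => [y ye y0|y z ye ze yz].
  have My : M y by rewrite -ye; case: iM => _ _; apply.
  have [s es] : princ y e by rewrite (minimal_ideal_princ mM My y0).
  by exists s.
have P0 : P 0 by case: iP.
have e'e : (1 - e) * e = 0 by rewrite mulrBl mul1r ee subrr.
have Pe : P ((1 - e) * e) by rewrite e'e.
have Qe : Q ((1 - e) * e) by rewrite e'e.
have sQP := splitting_primes_sym sPQ.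
have dom (A B : set R) : splitting_primes A B -> A (1 - e) -> y = 0 \/ z = 0.
  move=> sAB Ae; have [[[_ _ AM] _ _] _ _ _ _] := sAB.
  by apply: (splitting_primes_mul_neq0 sAB) => //; rewrite -1?ye -1?ze; exact: AM.
(* If [1 - e] lay in neither prime, [e] would lie in both and be zero. *)
case: (Pm _ _ Pe) => [|Pe']; first exact: dom sPQ.
case: (Qm _ _ Qe) => [|Qe']; first exact: dom sQP.
by move/eqP: e0; case; exact: PQ0.
Qed.

End Classification.

(** * Non-reduced rings *)

Section NonReduced.
Variable R : comPzRingType.
Implicit Types (I J K U V W : set R) (a b x y z e r : R).

Lemma idealM_princ_square0 a : a * a = 0 -> idealM (princ a) (princ a) = [set 0].
Proof.
move=> aa; apply/seteqP; split.
  apply: idealM_sub => [|_ _ [r ->] [s ->]] /=; last by rewrite mulrACA aa mulr0.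
  by split=> //= [x y -> ->|r x ->]; rewrite ?addr0 ?mulr0.
by move=> _ ->; case: (idealM_ideal (princ a) (princ_ideal a)).
Qed.

(** The vertex [U = (a)] is adjacent to all others, so no edge can avoid [U]. Each clause of the
    conclusion is proved by exhibiting the edge that its failure would create. *)
Lemma triangle_free_common_annihilator (a : R) V W :
    triangle_free (EG R) -> a != 0 -> a * a = 0 ->
    EG_vertex V -> EG_vertex W -> V <> princ a -> W <> princ a -> V <> W ->
  has_nonessential_common_annihilator R.
Proof.
move=> tf a0 aa vV vW Va Wa VW; pose U := princ a.
have na := square0_nilradical aa.
have vU : EG_vertex U by exact: nilpotent_vertex.
have adjU J : EG_vertex J -> U <> J -> EG_adj U J by exact: nilpotent_adj.
have nilU (y : R) : nilradical R y -> y != 0 -> princ y = U.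
  move=> ny y0; apply: contrapT => yU.
  (* One of [V] and [W] differs from [(y)], and it closes a triangle with [U] and [(y)]. *)
  have [T [vT TU Ty]] : exists T, [/\ EG_vertex T, U <> T & princ y <> T].
    case: (pselect (princ y = V)) => yV.
      by exists W; split=> //; [exact: nesym | rewrite yV].
    by exists V; split=> //; exact: nesym.
  apply: (tf U (princ y) T).
  - by apply: adjU; [exact: nilpotent_vertex | exact: nesym].
  - exact: adjU.
  - exact: nilpotent_adj.
have nilUP (y : R) : y * y = 0 -> U y.
  move=> yy; have [->|y0] := eqVneq y 0; first by case: (princ_ideal a).
  by rewrite -(nilU y (square0_nilradical yy) y0); exact: princ_id.
have minU : minimal_ideal U.
  apply: minimal_ideal_princP a0 _ => _ [r ->] ra0.
  rewrite (nilU (r * a)) //; first exact: princ_id.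
  by apply: square0_nilradical; rewrite mulrACA aa mulr0.
have UsubE I : EG_vertex I -> I `<=` U -> I = U.
  case: minU => _ _ minU /EG_vertexP[iI In0 _] IU.
  by apply: minU => //; exact/(ideal_neq0P iI).
have annU I : EG_vertex I -> I <> U -> Ann I = U.
  move=> vI IU; have /EG_vertexP[iI [x Ix x0] [y y0 yI]] := vI.
  have iK := Ann_ideal I.
  have vK : EG_vertex (Ann I).
    apply: (annihilated_vertex iK _ x0) => [|z Kz].
      by apply/(ideal_neq0P iK); exists y.
    by rewrite mulrC Kz.
  (* If [Ann I = I], the elements of [I] square to zero, which puts [I] inside [U]. Otherwise [U],
     [Ann I] and [I] form a triangle. *)
  apply: contrapT => KU; case: (pselect (Ann I = I)) => [KI|KI].
    apply: IU; apply: UsubE => // z Iz; apply: nilUP.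
    by move: (Iz); rewrite -{1}KI; apply.
  apply: (tf U (Ann I) I); [exact: adjU (nesym _)|exact: adjU (nesym _)|].
  by apply: EG_adj_mul0 => // z t; apply.
exists U; split=> //.
- have nz : exists x, x != 0 :> R by exists a.
  (* As [U = Ann V] kills [V W], an essential [U] would make [V] and [W] adjacent. *)
  move=> /(essential_idealP (princ_ideal a) nz) essU.
  apply: (tf U V W); [exact: adjU (nesym _)|exact: adjU (nesym _)|].
  apply/(EG_adjP vV vW VW) => y /essU[r [ry Ury]]; exists r; split=> // v w Vv _.
  have : Ann V (r * y) by rewrite annU.
  by move=> /(_ v Vv) E; rewrite mulrA E mul0r.
- exact: idealM_princ_square0.
- by move=> I [iI AnI] In0 IU; apply: annU.
Qed.

(** * Rings with at most two vertices *)

Section TwoVertices.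
Variables A B : set R.
Hypothesis vAB : forall I, EG_vertex I -> I = A \/ I = B.

Lemma two_vertices_third I J K : EG_vertex I -> EG_vertex J -> EG_vertex K ->
  I <> J -> K = I \/ K = J.
Proof.
by move=> /vAB[]-> /vAB[]-> /vAB[]->; auto.
Qed.

(** Otherwise some non-zero [m * b] does not generate [b], and [S = (b)] and [J = (m * b)] are the
    only vertices. The annihilators of both contain [b], so both equal [S]. This forces
    [(m * m * b) = J], whence [m * b = w * m * (m * b)]; then [1 - w * m] kills [m * b], hence also
    [b], and [b] is a multiple of [m * b] after all. *)
Lemma two_vertices_minimal b : b != 0 -> b * b = 0 -> minimal_ideal (princ b).
Proof.
move=> b0 bb; pose S := princ b; have nb := square0_nilradical bb.
have vS : EG_vertex S by exact: nilpotent_vertex.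
apply: minimal_ideal_princP => // _ [m ->] v0.
apply: contrapT => nvb; pose J := princ (m * b).
have vv : m * b * (m * b) = 0 by rewrite mulrACA bb mulr0.
have nv := square0_nilradical vv.
have vJ : EG_vertex J by exact: nilpotent_vertex.
have JS : J `<=` S by apply: princ_sub; [exact: princ_ideal | exists m].
have nJ : J <> S by move=> JSE; apply: nvb; rewrite -/J JSE; exact: princ_id.
have vertexS I : EG_vertex I -> I b -> I = S.
  move=> vI Ib; have [IJ|//] := two_vertices_third vJ vS vI nJ.
  by case: nvb; rewrite -/J -IJ.
have annS x : x != 0 -> b * x = 0 -> Ann (princ x) = S.
  move=> x0 bx; apply: vertexS; last exact/Ann_princP.
  apply: (annihilated_vertex (Ann_ideal _) _ x0) => [|z /Ann_princP].
    apply/(ideal_neq0P (Ann_ideal _)); exists b => //; exact/Ann_princP.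
  by rewrite mulrC.
have annb : Ann (princ b) = S by exact: annS.
have annv : Ann J = S by apply: annS; rewrite // mulrCA bb mulr0.
have [mv0|mv0] := eqVneq (m * (m * b)) 0.
  have : S m by rewrite -annv; apply/Ann_princP.
  by rewrite -annb => /Ann_princP mb; rewrite mb eqxx in v0.
have vmv : EG_vertex (princ (m * (m * b))).
  apply: nilpotent_vertex => //; apply: square0_nilradical.
  by rewrite mulrACA vv mulr0.
have mvJ : princ (m * (m * b)) = J.
  have [//|mvS] := two_vertices_third vJ vS vmv nJ.
  case: nvb; have : princ (m * (m * b)) b by rewrite mvS; exact: princ_id.
  by move=> [r bE]; exists (r * m); rewrite -mulrA.
have [w wv] : princ (m * (m * b)) (m * b) by rewrite mvJ; exact: princ_id.
have : S (1 - w * m).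
  by rewrite -annv; apply/Ann_princP; rewrite mulrBl mul1r -mulrA -wv subrr.
rewrite -annb => /Ann_princP; rewrite mulrBl mul1r => /eqP.
rewrite subr_eq0 => /eqP be; apply: nvb; exists w.
by rewrite mulrA.
Qed.

End TwoVertices.

(** With [U = (a)], the annihilators are vertices and turn out to satisfy [Ann U = V] and
    [Ann V = U]. Any [x] in [V] outside [U] then generates [V], with [(x * x) = U] and
    [x * x * x = 0]. *)
Lemma two_vertices_chain (a : R) V : a != 0 -> a * a = 0 -> EG_vertex V ->
    V <> princ a -> (forall I, EG_vertex I -> I = princ a \/ I = V) ->
  nilradical R <> idealM (nilradical R) (nilradical R) /\
  forall I, nontrivial_ideal I <->
    I = nilradical R \/ I = idealM (nilradical R) (nilradical R).
Proof.
move=> a0 aa vV VU vUV; pose U := princ a.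
have na := square0_nilradical aa.
have vU : EG_vertex U by exact: nilpotent_vertex.
have /EG_vertexP[iV [v Vv v0] [k k0 kV]] := vV.
have minU : minimal_ideal U by exact: (two_vertices_minimal vUV).
have iU := princ_ideal a.
have cancel z : z * a != 0 -> exists w, (1 - w * z) * a = 0.
  move=> za0; have Uza : U (z * a) by exists z.
  have [w aw] : princ (z * a) a.
    by rewrite (minimal_ideal_princ minU Uza za0); exact: princ_id.
  by exists w; rewrite mulrBl mul1r -mulrA -aw subrr.
have vAnn K x y : K y -> x != 0 -> y != 0 -> Ann K x -> EG_vertex (Ann K).
  move=> Ky x0 y0 Kx; apply: (annihilated_vertex (Ann_ideal _) _ y0).
    by apply/(ideal_neq0P (Ann_ideal _)); exists x.
  by move=> z Kz; rewrite mulrC Kz.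
have annaa : Ann U a by apply/Ann_princP.
have annU : Ann U = V.
  have [AU|//] := vUV _ (vAnn U a a (princ_id a) a0 a0 annaa).
  case: VU; case: minU => _ _; apply=> //; first by apply/(ideal_neq0P iV); exists v.
  move=> z Vz; have [za|za] := eqVneq (z * a) 0.
    by have /Ann_princP : z * a = 0 := za; rewrite AU.
  have [w /Ann_princP] := cancel z za; rewrite AU => -[r wz].
  (* Since [a] squares to zero, [1 + r * a] inverts [w * z = 1 - r * a]; this would put 1 in the
     annihilated ideal [V]. *)
  have u1 : (1 + r * a) * (w * z) = 1.
    have -> : w * z = 1 - r * a by rewrite -wz; ring.
    have -> : (1 + r * a) * (1 - r * a) = 1 - r * r * (a * a) by ring.
    by rewrite aa mulr0 subr0.
  have V1 : V 1 by rewrite -u1 mulrA; case: iV => _ _; apply.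
  by move/eqP: k0; case; rewrite -[k]mulr1 kV.
have Va : V a by rewrite -annU.
have [x Vx Ux] : exists2 x, V x & ~ U x.
  apply: contrapT => nx; apply: VU; apply/seteqP; split; last exact: princ_sub.
  by move=> x Vx; apply: contrapT => Ux; apply: nx; exists x.
have xa : x * a = 0 by apply/(Ann_princP a); rewrite annU.
have x0 : x != 0 by apply/eqP => x0; apply: Ux; rewrite x0; case: iU.
have princV y : V y -> ~ U y -> princ y = V.
  move=> Vy Uy; have y0 : y != 0 by apply/eqP => y0; apply: Uy; rewrite y0; case: iU.
  have ya : y * a = 0 by apply/(Ann_princP a); rewrite annU.
  have [yU|//] := vUV _ (princ_vertex y0 a0 ya).
  by case: Uy; rewrite /U -yU; exact: princ_id.
have xV : princ x = V by exact: princV.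
have annVa : Ann V a by rewrite -xV; apply/Ann_princP; rewrite mulrC.
have annV : Ann V = U.
  have [//|AV] := vUV _ (vAnn V a x Vx a0 x0 annVa).
  (* If [Ann V = V], then [V = (x)] is minimal too; containing [a], it would equal [U]. *)
  have xx : x * x = 0 by apply/(Ann_princP x); rewrite xV AV.
  have minV : minimal_ideal (princ x) by exact: (two_vertices_minimal vUV).
  case: VU; rewrite -[LHS]xV; symmetry.
  by apply: minimal_ideal_princ minV _ a0; rewrite xV.
have xx0 : x * x != 0.
  by apply/eqP => xx; apply: Ux; rewrite -annV -xV; apply/Ann_princP.
have xxU : princ (x * x) = U.
  have [|//|xxV] := vUV (princ (x * x)).
    by apply: princ_vertex xx0 a0 _; rewrite -mulrA xa mulr0.
  have [r xr] : princ (x * x) x by rewrite xxV.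
  have : Ann V (1 - r * x).
    by rewrite -xV; apply/Ann_princP; rewrite mulrBl mul1r -mulrA -xr subrr.
  rewrite annV => U1; have V1 : V 1.
    rewrite -(subrK (r * x) 1); case: (iV) => _ VD VM; apply: VD; last exact: VM.
    by move: U1 => [s ->]; apply: VM.
  by move/eqP: k0; case; rewrite -[k]mulr1 kV.
have xxx : x * x * x = 0.
  apply/(Ann_princP x); rewrite xV annV -xxU; exact: princ_id.
have nilV : nilradical R = V.
  apply/seteqP; split=> [y ny|y].
    have [->|y0] := eqVneq y 0; first by case: iV.
    have [yU|<-] := vUV _ (nilpotent_vertex ny y0); last exact: princ_id.
    have : U y by rewrite /U -yU; exact: princ_id.
    by apply: princ_sub.
  rewrite -{1}xV => -[r ->]; exists 3%N.
  have -> : (r * x) ^+ 3 = r ^+ 3 * (x * x * x) by ring.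
  by rewrite xxx mulr0.
have nil2 : idealM V V = U.
  apply/seteqP; split.
    rewrite -xV -xxU; apply: idealM_sub; first exact: princ_ideal.
    by move=> _ _ [r ->] [s ->]; exists (r * s); rewrite mulrACA.
  rewrite -xxU; apply: princ_sub; first exact: idealM_ideal.
  exact: idealM_mul.
rewrite nilV nil2; split=> // I; split=> [[iI In0 /(ideal_neqTP iI) I1]|].
  suff : EG_vertex I by move/vUV => [->|->]; [right|left].
  (* A proper ideal is killed by [a]: otherwise [1 - w * z = s * x] for some [z] in it, and [w * z]
     is a unit, inverted by the geometric series that stops because [x] cubes to zero. *)
  apply: (annihilated_vertex iI In0 a0) => z Iz; rewrite mulrC.
  apply: contrapT => /eqP /cancel[w wz]; apply: I1.
  have : V (1 - w * z) by rewrite -annU; apply/Ann_princP.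
  rewrite -xV => -[s wzE].
  have <- : (1 + s * x + s * x * (s * x)) * w * z = 1.
    have -> : (1 + s * x + s * x * (s * x)) * w * z =
      (1 + s * x + s * x * (s * x)) * (1 - (1 - w * z)) by ring.
    rewrite wzE.
    have -> : (1 + s * x + s * x * (s * x)) * (1 - s * x) =
      1 - s * s * s * (x * x * x) by ring.
    by rewrite xxx mulr0 subr0.
  by case: iI => _ _; apply.
by case=> ->; exact: vertex_nontrivial.
Qed.

(** * Star graphs obtained from the non-reduced classes *)

Lemma star_bipartition U : EG_vertex U ->
    (forall J, EG_vertex J -> U <> J -> EG_adj U J) ->
    (forall I J, EG_vertex I -> EG_vertex J -> I <> U -> J <> U -> ~ EG_adj I J) ->
  complete_bipartition (EG R) [set U] [set J | EG_vertex J /\ J <> U].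
Proof.
move=> vU adjU nadj; split; last first.
  by move=> _ J -> [vJ JU]; apply: adjU (nesym _).
split.
- apply/seteqP; split=> [J [->|[]]//|J vJ].
  by case: (pselect (J = U)) => JU; [left|right].
- by apply/seteqP; split=> // J [-> []].
- by move=> _ _ -> ->; exact: adj_irrefl.
- by move=> I J [vI IU] [vJ JU]; exact: nadj.
Qed.

(** A nilpotent [x] outside [N2] generates [N], as [(x)] is non-trivial and differs from [N2]. So
    [N] is a vertex adjacent to all others, and [N2] is the only other one. *)
Lemma chain_is_K11 :
    nilradical R <> idealM (nilradical R) (nilradical R) ->
    (forall I, nontrivial_ideal I <->
       I = nilradical R \/ I = idealM (nilradical R) (nilradical R)) ->
  is_K (EG R) (Some 1%N) (Some 1%N).
Proof.
set N := nilradical R; set N2 := idealM N N => NN2 nt.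
have [iN Nn0 NT] : nontrivial_ideal N by apply/nt; left.
have [iN2 N2n0 _] : nontrivial_ideal N2 by apply/nt; right.
have N2N : N2 `<=` N.
  by apply: idealM_sub => // x y _ Ny; case: iN => _ _; apply.
have [x Nx N2x] : exists2 x, N x & ~ N2 x.
  apply: contrapT => nx; apply: NN2; apply/seteqP; split=> // x Nx.
  by apply: contrapT => N2x; apply: nx; exists x.
have x0 : x != 0 by apply/eqP => x0; apply: N2x; rewrite x0; case: iN2.
have vx := nilpotent_vertex Nx x0.
have xN : princ x = N.
  have /nt[//|xN2] := vertex_nontrivial vx.
  by case: N2x; rewrite -xN2; exact: princ_id.
have vN : EG_vertex N by rewrite -xN.
have vN2 : EG_vertex N2.
  have /EG_vertexP[_ _ [y y0 yN]] := vN.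
  by apply: (annihilated_vertex iN2 N2n0 y0) => z /N2N/yN.
exists [set N], [set J | EG_vertex J /\ J <> N]; split.
- apply: star_bipartition => // [J vJ NJ|I J vI vJ IN JN aIJ].
    by rewrite -xN in NJ *; exact: nilpotent_adj.
  have [] := (nt I).1 (vertex_nontrivial vI) => // I2.
  have [] := (nt J).1 (vertex_nontrivial vJ) => // J2.
  by move: aIJ; rewrite I2 J2 => -[].
- exact: card_set1.
- suff -> : [set J | EG_vertex J /\ J <> N] = [set N2] by exact: card_set1.
  apply/seteqP; split=> [J [/vertex_nontrivial/nt[]//]|_ ->].
  by split=> //; exact: nesym.
Qed.

(** The non-essential [U] contains every nilpotent and is the centre of the star. The second vertex
    supplies some [V <> U], and the powers of an element of [V] outside [U] give infinitely many
    leaves. *)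
Lemma common_annihilator_is_K :
    has_nonessential_common_annihilator R ->
    (exists I J : set R, [/\ EG_vertex I, EG_vertex J & I <> J]) ->
  is_K (EG R) (Some 1%N) None.
Proof.
move=> [U [minU nessU UU annU]] [I0 [J0 [vI0 vJ0 IJ0]]].
have [iU /(ideal_neq0P iU)[a Ua a0] _] := minU.
have UsubE I : EG_vertex I -> I `<=` U -> I = U.
  move=> /EG_vertexP[iI In0 _] IU; case: minU => _ _; apply=> //.
  exact/(ideal_neq0P iI).
have sq0 x : U x -> x * x = 0.
  by move=> Ux; have := idealM_mul Ux Ux; rewrite UU.
have aU : princ a = U by exact: minimal_ideal_princ.
have na := square0_nilradical (sq0 _ Ua).
have vU : EG_vertex U by rewrite -aU; exact: nilpotent_vertex.
have nz : exists x, x != 0 :> R by exists a.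
have annV I : EG_vertex I -> I <> U -> Ann I = U.
  by move=> [aI In0]; exact: annU.
have ness : ~ forall y, y != 0 -> exists r, r * y != 0 /\ U (r * y).
  by move=> /(essential_idealP iU nz).
have nilU (y : R) : nilradical R y -> U y.
  move=> ny; have [->|y0] := eqVneq y 0; first by case: iU.
  have vy := nilpotent_vertex ny y0.
  case: (pselect (princ y = U)) => [<-|yU]; first exact: princ_id.
  (* Otherwise [U] would be the annihilator of the nilpotent [y], which is essential. *)
  case: ness => z z0; have [r [rz yrz]] := nilpotent_kills ny z0.
  exists r; split=> //; rewrite -(annV _ vy yU); apply/Ann_princP.
  by rewrite mulrC.
have cancel x (z : R) : (exists2 I, EG_vertex I & I x) -> ~ U x -> z * x = 0 -> U z.
  move=> [I /EG_vertexP[_ _ [y y0 yI]] Ix] Ux zx.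
  have x0 : x != 0 by apply/eqP => x0; apply: Ux; rewrite x0; case: iU.
  have xy : x * y = 0 by rewrite mulrC yI.
  have vx := princ_vertex x0 y0 xy.
  rewrite -(annV _ vx); first exact/Ann_princP.
  by move=> xU; apply: Ux; rewrite -xU; exact: princ_id.
have out I : EG_vertex I -> I <> U -> exists2 x, I x & ~ U x.
  move=> vI IU; apply: contrapT => nx; apply: IU; apply: UsubE => // x Ix.
  by apply: contrapT => Ux; apply: nx; exists x.
exists [set U], [set J | EG_vertex J /\ J <> U]; split; last 2 first.
- exact: card_set1.
- have [V vV VU] : exists2 V, EG_vertex V & V <> U.
    case: (pselect (I0 = U)) => [I0U|]; last by exists I0.
    by exists J0 => // J0U; apply: IJ0; rewrite J0U.
  have [x Vx Ux] := out V vV VU.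
  have /EG_vertexP[iV _ [y y0 yV]] := vV.
  have Vxn n : V (x ^+ n.+1) by rewrite exprSr; case: iV => _ _; apply.
  have Uxn n : ~ U (x ^+ n.+1).
    move=> /sq0 xn; apply: Ux; apply: nilU; exists (n.+1 + n.+1)%N.
    by rewrite exprD.
  have [n|//|[n [e [ee [s es] exn]]]] :=
      @powers_infinite R [set J | EG_vertex J /\ J <> U] x.
    split=> [|xU]; last by apply: (Uxn n); rewrite -xU; exact: princ_id.
    apply: (princ_vertex _ y0); last by rewrite mulrC yV.
    by apply/eqP => xn; apply: (Uxn n); rewrite xn; case: iU.
  (* Elements of [U] square to zero while [1 - e] is idempotent, so [e = 1] would lie in the
     annihilated ideal [V]. *)
  have : U (1 - e).
    apply: (cancel (x ^+ n.+1)) => //; first by exists V.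
    by rewrite mulrBl mul1r exn subrr.
  move=> /sq0; have -> : (1 - e) * (1 - e) = 1 - e by ring: ee.
  move=> /eqP; rewrite subr_eq0 => /eqP e1.
  move/eqP: y0; case; rewrite -[y]mulr1 e1; apply: yV.
  by rewrite es; case: iV => _ _; apply.
apply: star_bipartition => // [J vJ|I J vI vJ IU JU aIJ].
  by rewrite -aU; exact: nilpotent_adj.
have [x Ix Ux] := out I vI IU; have [y Jy Uy] := out J vJ JU.
(* Since [U = Ann I] kills [x], [z * x * x = 0]. The square of [x] is outside [U], as otherwise its
   fourth power would vanish and [x] would be a nilpotent outside [U]. *)
have Ux' z : U (z * x) -> U z.
  rewrite -{1}(annV I vI IU) => /(_ x Ix) zxx.
  apply: (cancel (x * x)); last by rewrite mulrA.
    by exists I => //; have /EG_vertexP[[_ _ IM] _ _] := vI; exact: IM.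
  by move=> /sq0 xx; apply: Ux; apply: nilU; exists 4%N; rewrite -xx; ring.
have /EG_vertexP[[_ _ JM] _ _] := vJ.
have IJ : I <> J by case: aIJ.
(* An edge gives every non-zero [w] a non-zero multiple killing [x * y]. As [x * y] is not in [U],
   that multiple is in [U], which would be essential. *)
apply: ness => w /((EG_adjP vI vJ IJ).1 aIJ)[r [rw rwIJ]]; exists r; split=> //.
apply: (cancel (x * y)); last exact: rwIJ.
  by exists J => //; exact: JM.
by rewrite mulrC => /Ux'.
Qed.

End NonReduced.

(** * The equivalence *)

Section Equivalence.
Variable R : comPzRingType.
Hypothesis two_vertices :
  exists I J : set R, [/\ EG_vertex I, EG_vertex J & I <> J].

Local Notation classes :=
  ((exists F1 F2 : fieldType, ring_isomorphic R (F1 * F2)%type) \/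
   (exists (F : fieldType) (D : idomainType),
      ring_isomorphic R (F * D)%type) \/
   [/\ reduced R, (Min R #= `I_2)%card & Soc R = [set 0]] \/
   (nilradical R <> idealM (nilradical R) (nilradical R) /\
    forall I : set R,
      nontrivial_ideal I <->
      I = nilradical R \/ I = idealM (nilradical R) (nilradical R)) \/
   has_nonessential_common_annihilator R).

Local Notation stars_or_infinite :=
  (is_K (EG R) (Some 1%N) (Some 1%N) \/
   is_K (EG R) (Some 1%N) None \/
   is_K (EG R) None None).

(** The case split is on reducedness. A reduced ring is then sorted by the existence of a minimal
    ideal, a non-reduced one by the existence of a third vertex. *)
Lemma triangle_free_classes : triangle_free (EG R) -> classes.
Proof.
move=> tf; have [I0 [J0 [vI0 vJ0 IJ0]]] := two_vertices.
case: (pselect (reduced R)) => [red|/not_reduced_square0[a a0 aa]].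
  have [P [Q sPQ]] := triangle_free_splitting_primes tf red vI0.
  case: (pselect (exists M : set R, minimal_ideal M)) => [[M mM]|nomin].
    by right; left; exact: splitting_primes_minimal_ideal sPQ mM.
  right; right; left; split=> //; first exact: splitting_primes_Min sPQ.
  exact: Soc_no_minimal.
have [V vV Va] : exists2 V : set R, EG_vertex V & V <> princ a.
  case: (pselect (I0 = princ a)) => [I0a|]; last by exists I0.
  by exists J0 => // J0a; apply: IJ0; rewrite J0a.
case: (pselect (forall I : set R, EG_vertex I -> I = princ a \/ I = V)) => [vaV|].
  by do 3!right; left; exact: two_vertices_chain a0 aa vV Va vaV.
move=> /existsNP[W /not_implyP[vW /not_orP[Wa WV]]].
do 4!right.
exact: triangle_free_common_annihilator tf a0 aa vV vW Va Wa (nesym WV).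
Qed.

Lemma classes_is_K : classes -> stars_or_infinite.
Proof.
case=> [[F1 [F2 iso]]|[[F [D iso]]|[[red Min2 _]|[[NN2 nt]|com]]]].
- have [P [Q sPQ]] := domain_product_splitting_primes iso.
  exact: splitting_primes_is_K sPQ.
- have [P [Q sPQ]] := domain_product_splitting_primes iso.
  exact: splitting_primes_is_K sPQ.
- have [P [Q sPQ]] := Min2_splitting_primes red Min2.
  exact: splitting_primes_is_K sPQ.
- by left; exact: chain_is_K11.
- by right; left; exact: common_annihilator_is_K.
Qed.

Lemma stars_or_infinite_complete_bipartite :
  stars_or_infinite -> complete_bipartite (EG R).
Proof. by case=> [|[]]; apply: is_K_complete_bipartite. Qed.

End Equivalence.

Theorem theorem2p3 (R : comPzRingType)
  (hR : exists I J : set R,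
     [/\ nontrivial_ideal I, annihilating_ideal I,
         nontrivial_ideal J, annihilating_ideal J & I <> J]) :
  [<-> clique_number_is (EG R) 2;
       chromatic_number_is (EG R) 2;
       bipartite (EG R);
       complete_bipartite (EG R);
       is_K (EG R) (Some 1%N) (Some 1%N) \/
       is_K (EG R) (Some 1%N) None \/
       is_K (EG R) None None;
       (exists F1 F2 : fieldType, ring_isomorphic R (F1 * F2)%type) \/
       (exists (F : fieldType) (D : idomainType),
          ring_isomorphic R (F * D)%type) \/
       [/\ reduced R, (Min R #= `I_2)%card & Soc R = [set 0]] \/
       (nilradical R <> idealM (nilradical R) (nilradical R) /\
        forall I : set R,
          nontrivial_ideal I <->
          I = nilradical R \/ I = idealM (nilradical R) (nilradical R)) \/
       has_nonessential_common_annihilator R].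
Proof.
have vtx : exists I J : set R, [/\ EG_vertex I, EG_vertex J & I <> J].
  have [I [J [[_ I0 _] aI [_ J0 _] aJ IJ]]] := hR.
  by exists I, J.
have tf6 := triangle_free_classes vtx; have s65 := classes_is_K vtx.
have s54 := @stars_or_infinite_complete_bipartite R.
(* Triangle-freeness is the hub: the first four statements each imply it, and it yields the ring
   classes, then the explicit graphs, then complete bipartiteness. *)
have tf4 : triangle_free (EG R) -> complete_bipartite (EG R).
  by move=> /tf6/s65/s54.
have tf2 : bipartite (EG R) -> triangle_free (EG R).
  by move=> /bipartite_colorable2; exact: colorable2_triangle_free.
have tf3 := @complete_bipartite_bipartite _ (EG R).
tfae.
- move=> /clique_number2_triangle_free/tf4.
  exact: complete_bipartite_chromatic_number2.
- by move=> [/colorable2_triangle_free/tf4/tf3].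
- by move=> /tf2/tf4.
- by move=> /tf3/tf2/tf6/s65.
- by move=> /s54/tf3/tf2/tf6.
- by move=> /s65/s54; exact: complete_bipartite_clique_number2.
Qed.
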